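(* Let $\mathbf{A}$ be an epireflective subcategory of $\mathbf{Top}$ with $I_2\notin\mathbf{A}$. If $\mathbf{B}$ is an HAD-class in $\mathbf{A}$ and $\mathbf{B}$ contains at least one space which is not locally connected, then $\mathbf{B}$ is closed under the formation of prime factors.
   Context: $\mathbf{Top}$ is the category of topological spaces and continuous maps. All subcategories are full and isomorphism-closed (so they are identified with classes of spaces), and every subcategory of $\mathbf{Top}$ is assumed to contain at least one space with at least two points. A subcategory of $\mathbf{Top}$ is epireflective in $\mathbf{Top}$ if and only if it is closed under topological products and subspaces. $I_2$ is the two-point indiscrete space. A class $\mathbf{B}\subseteq\mathbf{A}$ is an AD-class in $\mathbf{A}$ if it is additive (closed under topological sums, i.e. disjoint unions) and divisible in $\mathbf{A}$ (if $q\colon X\to Y$ is a quotient map with $X\in\mathbf{B}$ and $Y\in\mathbf{A}$, then $Y\in\mathbf{B}$). It is an HAD-class in $\mathbf{A}$ if moreover it is hereditary, i.e. closed under subspaces. A space $X$ is locally connected if for every $x\in X$ and every open neighborhood $U$ of $x$ there is a connected open neighborhood $V\subseteq U$ of $x$. For a space $X$ and $a\in X$, the prime factor $X_a$ of $X$ at $a$ is the space on the same set in which all points different from $a$ are isolated and the neighborhoods of $a$ are the same as in $X$. A class $\mathbf{B}$ is closed under the formation of prime factors if $X_a\in\mathbf{B}$ for all $X\in\mathbf{B}$ and $a\in X$. *)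

(* Defs.v *)
From HB Require Import structures.
From mathcomp Require Import all_boot all_classical topology.

Set Implicit Arguments.
Unset Strict Implicit.
Unset Printing Implicit Defensive.

Local Open Scope classical_set_scope.

(* A full subcategory of Top is given by its class of objects. Mathcomp's
   [topologicalType] carries a choice structure, which every type has
   classically; isomorphism-closedness makes membership independent of it. *)
Definition space_class := topologicalType -> Prop.

Definition homeomorphism (X Y : topologicalType) (f : X -> Y) : Prop :=
  continuous f /\
  exists g : Y -> X, [/\ continuous g, cancel f g & cancel g f].

Definition isomorphism_closed (A : space_class) : Prop :=
  forall (X Y : topologicalType) (f : X -> Y), homeomorphism f -> A X -> A Y.

Definition subcategory (A : space_class) : Prop :=
  isomorphism_closed A /\
  exists X : topologicalType, A X /\ exists x y : X, x <> y.

Definition epimorphism (X Y : topologicalType) (r : X -> Y) : Prop :=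
  continuous r /\
  forall (Z : topologicalType) (g h : Y -> Z),
    continuous g -> continuous h -> g \o r = h \o r -> g = h.

Definition reflection (A : space_class) (X RX : topologicalType)
    (r : X -> RX) : Prop :=
  [/\ A RX, continuous r &
      forall (Y : topologicalType) (f : X -> Y), A Y -> continuous f ->
        exists! g : RX -> Y, continuous g /\ g \o r = f].

(* For an isomorphism-closed class this is equivalent to closure under
   topological products and subspaces. *)
Definition epireflective (A : space_class) : Prop :=
  forall X : topologicalType, exists (RX : topologicalType) (r : X -> RX),
    reflection A r /\ epimorphism r.

(* [bool] itself carries the discrete topology in the library. *)
Definition I2 : Type := bool.

HB.instance Definition _ := Choice.on I2.

Section I2_topology.
Let op : set_system I2 := [set U | U = set0 \/ U = setT].

Let opT : op setT. Proof. by right. Qed.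

Let opI : setI_closed op.
Proof.
move=> U V [->|->] [->|->]; rewrite ?set0I ?setI0 ?setTI; by [left | right].
Qed.

Let op_bigU (I : Type) (f : I -> set I2) :
  (forall i, op (f i)) -> op (\bigcup_i f i).
Proof.
move=> opf; have [[i fiT]|nT] := pselect (exists i, f i = setT).
  by right; apply/seteqP; split=> // x _; exists i; rewrite ?fiT.
left; apply/seteqP; split=> // x [i _].
by case: (opf i) => [->//|fiT]; case: nT; exists i.
Qed.

HB.instance Definition _ := isOpenTopological.Build I2 opT opI op_bigU.

End I2_topology.

Definition quotient_map (X Y : topologicalType) (q : X -> Y) : Prop :=
  (forall y : Y, exists x : X, q x = y) /\
  (forall U : set Y, open U <-> open (q @^-1` U)).

Definition additive_class (B : space_class) : Prop :=
  forall (I : choiceType) (X : I -> topologicalType),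
    (forall i, B (X i)) -> B {i : I & X i}.

Definition divisible_in (A B : space_class) : Prop :=
  forall (X Y : topologicalType) (q : X -> Y),
    quotient_map q -> B X -> A Y -> B Y.

(* The coercion [set_type] equips [S : set X] with the subspace topology. *)
Definition hereditary (B : space_class) : Prop :=
  forall (X : topologicalType) (S : set X), B X -> B (S : Type).

Definition AD_class (A B : space_class) : Prop :=
  [/\ forall X, B X -> A X, additive_class B & divisible_in A B].

Definition HAD_class (A B : space_class) : Prop :=
  AD_class A B /\ hereditary B.

Definition locally_connected (X : topologicalType) : Prop :=
  forall (x : X) (U : set X), open U -> U x ->
    exists V : set X, [/\ open V, V x, connected V & V `<=` U].

Definition prime_factor (X : Type) (a : X) : Type := X.

Section prime_factor_topology.
Context {X : topologicalType} (a : X).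
Local Notation Xa := (prime_factor a).

Definition prime_factor_nbhs (x : Xa) : set_system Xa :=
  if x == a :> X then nbhs a else principal_filter x.

HB.instance Definition _ := Choice.copy Xa X.
HB.instance Definition _ := hasNbhs.Build Xa prime_factor_nbhs.

Let nbhs_proper (x : Xa) : ProperFilter (nbhs x).
Proof.
rewrite /nbhs /= /prime_factor_nbhs; case: ifP => _.
  exact: nbhs_pfilter.
exact: principal_filter_proper.
Qed.

Let nbhs_self (x : Xa) (A : set Xa) : nbhs x A -> A x.
Proof.
rewrite /nbhs /= /prime_factor_nbhs; case: ifP => [/eqP ->|_].
  exact: nbhs_singleton.
by move/principal_filterP.
Qed.

Let nbhs_idem (x : Xa) (A : set Xa) : nbhs x A -> nbhs x (nbhs^~ A).
Proof.
move=> xA; have := xA; rewrite {1 2}/nbhs /= /prime_factor_nbhs.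
case: ifP => [/eqP xa|_ _]; last exact/principal_filterP.
apply: filterS => y Ay; have [-> |ya] := eqVneq (y : X) a.
  by rewrite -xa.
rewrite /nbhs /= /prime_factor_nbhs (negbTE ya).
exact/principal_filterP.
Qed.

HB.instance Definition _ :=
  Nbhs_isNbhsTopological.Build Xa nbhs_proper nbhs_self nbhs_idem.

End prime_factor_topology.

Definition closed_under_prime_factors (B : space_class) : Prop :=
  forall (X : topologicalType) (a : X), B X -> B (prime_factor a).

(* Main.v *)
(* Call Z a Hausdorff prime space with center z if {p} is clopen for every p
   other than z while {z} is not open.

   B contains such a space. Given Y in B and x in Y, take a maximal disjoint
   family of nonempty clopen sets avoiding x and let D be the complement of its
   union. If D is not open, collapsing D and every member of the family gives a
   quotient of Y that is a Hausdorff prime space; it is zero-dimensional, hence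
   in A and in B. If D is open for all Y and x, then D is connected by
   maximality, and applying this to the open subspaces Y of X shows that every
   X in B is locally connected.

   Given X in B, a in X and a Hausdorff prime space Z in B with center z, glue
   a copy of Z at z to every point of X. The resulting quotient W of a sum
   carries the initial topology for its retraction onto X and its clopen sets,
   so W is in A, hence in B. Remove from W the copy of Z at a except for a
   itself, and all other points of X. As z is not isolated, sending each
   remaining point to its foot in X is a quotient map onto the prime factor. *)
Require Import Defs.
From HB Require Import structures.
From mathcomp Require Import all_boot all_classical topology.

Set Implicit Arguments.
Unset Strict Implicit.
Unset Printing Implicit Defensive.

Local Open Scope classical_set_scope.

(** * Membership in an epireflective class by initial topologies *)

Definition class_cvg (A : space_class) (Y : topologicalType)
    (F : set_system Y) (y : Y) : Prop :=
  forall (Z : topologicalType) (f : Y -> Z),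
    A Z -> continuous f -> f @ F --> f y.

(** All maps into [I2] are continuous, so the constant [true] and the indicator of the image of [r]
    can be compared through [r]. *)
Lemma epimorphism_surj (X Y : topologicalType) (r : X -> Y) :
  epimorphism r -> forall y, exists x, r x = y.
Proof.
move=> [_ epi] y.
have contI2 (g : Y -> I2) : continuous g.
  apply/continuousP => U [->|->]; rewrite ?preimage_set0 ?preimage_setT.
    exact: open0.
  exact: openT.
have /(congr1 (fun g : Y -> I2 => g y)) : (fun=> true : I2) =
    (fun y => `[< exists x, r x = y >] : I2).
  apply: epi; rewrite //.
  by apply/funext => x /=; apply/esym/asboolP; exists x.
by move/esym/asboolP.
Qed.

(** [class_cvg] is convergence in the initial topology of all maps into members of [A]. The
    reflection map is onto as an epimorphism and injective by separation. Maps into members of [A]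
    factor through it, which makes its inverse continuous. *)
Lemma epireflective_initial (A : space_class) (Y : topologicalType) :
  isomorphism_closed A -> epireflective A ->
  (forall x y : Y, x <> y -> exists (Z : topologicalType) (f : Y -> Z),
    [/\ A Z, continuous f & f x <> f y]) ->
  (forall (F : set_system Y) (y : Y), Filter F -> class_cvg A F y -> F --> y) ->
  A Y.
Proof.
move=> isoA epiA sepY cvgY.
have [RY [r [[ARY cr univ] epir]]] := epiA Y.
have /choice[g rK] := epimorphism_surj epir.
have gK : cancel r g.
  move=> x; apply: contrapT => /sepY[Z [f [AZ cf]]]; apply.
  have [h [[_ <-] _]] := univ Z f AZ cf.
  by rewrite /= rK.
apply: (isoA _ _ g _ ARY); split; last by exists r.
move=> z; apply: cvgY => Z f AZ cf.
have [h [[ch fE] _]] := univ Z f AZ cf.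
have fgE : f \o g = h by apply/funext => y; rewrite -fE /= rK.
have := ch z; rewrite -fgE; exact.
Qed.

Lemma clopen_indicator (Y : topologicalType) (K : set Y) :
  clopen K -> continuous (fun y => `[< K y >] : bool).
Proof.
move=> [oK cK]; apply/continuousP => U _.
have -> : (fun y => `[< K y >] : bool) @^-1` U =
    (if `[< U true >] then K else set0) `|`
    (if `[< U false >] then ~` K else set0).
  apply/seteqP; split => y /=.
    case: (asboolP (K y)) => Ky Ub; [left|right]; case: asboolP => //.
  by case: (asboolP (U true)); case: (asboolP (U false)) => ? ? [] //=;
    case: asboolP.
have oK' : open (~` K) by exact: closed_openC.
by apply: openU; case: ifP => // _; exact: open0.
Qed.

Lemma class_cvg_clopen (A : space_class) (Y : topologicalType)
    (F : set_system Y) (y : Y) (K : set Y) :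
  A bool -> class_cvg A F y -> clopen K -> K y -> F K.
Proof.
move=> Abool Fy cloK Ky.
have /(_ [set true]) := Fy _ _ Abool (clopen_indicator cloK).
rewrite (asboolT Ky) => /(_ (discrete_set1 _)).
by rewrite /fmap /=; congr F; apply/seteqP; split => x /= /asboolP.
Qed.

(** * Separation and prime factors in an epireflective class without [I2] *)

Section epireflective_class.
Variable A : space_class.
Hypotheses (isoA : isomorphism_closed A) (epiA : epireflective A).
Hypothesis I2_notin_A : ~ A I2.

(** If no open set tells [x] from [y], the map of [I2] onto these two points is continuous and
    injective, which puts [I2] in [A]. *)
Lemma epireflective_T0 (X : topologicalType) (x y : X) : A X -> x <> y ->
  exists U : set X, open U /\ ((U x /\ ~ U y) \/ (U y /\ ~ U x)).
Proof.
move=> AX xy; apply: contrapT => nsep.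
have same U : open U -> U x <-> U y.
  move=> oU; split=> ?; apply: contrapT => ?; apply: nsep; exists U; tauto.
apply: I2_notin_A; pose f (b : I2) := if b then x else y.
have cf : continuous f.
  apply/continuousP => U oU; have [Ux|nUx] := pselect (U x).
    by right; apply/seteqP; split => -[]//= _; exact/(same U).
  by left; apply/seteqP; split => -[]//= /(same _ oU).
apply: epireflective_initial => //.
  move=> b c bc; exists X, f; split => //.
  by case: b bc; case: c => //= _ /esym.
move=> F b FF _ U; rewrite nbhsE => -[V [oV Vb] VU].
case: oV Vb VU => [->//|-> _ VU]; apply: filterS VU _; exact: filterT.
Qed.

Lemma epireflective_bool :
  (exists X : topologicalType, A X /\ exists x y : X, x <> y) -> A bool.
Proof.
move=> [X [AX [x0 [y0 xy0]]]].
have [x [y [U [oU Ux nUy]]]] :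
    exists x y : X, exists U, [/\ open U, U x & ~ U y].
  have [U [oU [[]|[]]]] := epireflective_T0 AX xy0.
  - by exists x0, y0, U.
  - by exists y0, x0, U.
have cbool (f : bool -> X) : continuous f.
  by apply/continuousP => V _; exact: discrete_open.
(* The preimage of [U] under [f b] is the singleton of [b], so these maps detect the discrete
   topology. *)
pose f (b c : bool) := if b == c then x else y.
apply: epireflective_initial => //.
  move=> b c bc; exists X, (f b); split => //.
  rewrite /f eqxx; case: eqP bc => // _ _ xy; by rewrite -xy in nUy.
move=> F b FF /(_ X (f b) AX (cbool _) U).
rewrite nbhs_simpl /f eqxx => FU V Vb.
have : F (f b @^-1` U) by apply: FU; exact: open_nbhs_nbhs.
apply: filterS => c /=; rewrite /f; case: eqP => [<- _|//].
exact: nbhs_singleton Vb.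
Qed.

Hypothesis Abool : A bool.

Lemma prime_factor_open1 (X : topologicalType) (a : X) (x : prime_factor a) :
  x <> a -> open [set x].
Proof.
move=> xa; rewrite openE => _ ->; rewrite /interior /nbhs/= /prime_factor_nbhs.
by rewrite ifF; [exact/principal_filterP|exact/negbTE/eqP].
Qed.

Lemma prime_factor_nbhs_center (X : topologicalType) (a : X) :
  nbhs (a : prime_factor a) = nbhs a.
Proof. by rewrite {1}/nbhs/= /prime_factor_nbhs eqxx. Qed.

Lemma prime_factor_id_continuous (X : topologicalType) (a : X) :
  continuous (fun x : prime_factor a => x : X).
Proof.
move=> x U Ux; rewrite /fmap/= /nbhs/= /prime_factor_nbhs.
case: eqP => [<-//|_]; apply/principal_filterP; exact: nbhs_singleton Ux.
Qed.

(** The identity into [X] separates points and settles convergence at [a]. At [x] other than [a] the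
    filter must contain the singleton of [x], which is clopen unless [x] lies in every neighborhood
    of [a]. *)
Lemma epireflective_prime_factor (X : topologicalType) (a : X) :
  A X -> A (prime_factor a).
Proof.
move=> AX; have cont_id := @prime_factor_id_continuous X a.
apply: epireflective_initial => //.
  by move=> x y xy; exists X, (fun x => x).
move=> F x FF Fx U Ux; have FidE := Fx _ _ AX cont_id.
have [xa|xa] := eqVneq (x : X) a.
  by apply: FidE; rewrite xa in Ux *; rewrite prime_factor_nbhs_center in Ux.
suff Fx1 : F [set x] by apply: filterS Fx1 => _ ->; exact: nbhs_singleton Ux.
have ox : open [set x] by apply: prime_factor_open1; exact/eqP.
have [ax|nax] := pselect (nbhs (a : prime_factor a) (~` [set x])).
  apply: (class_cvg_clopen Abool Fx) => //; split=> //.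
  rewrite -openC openE => y yx; have [->//|ya] := eqVneq (y : X) a.
  apply: filterS (_ : [set y] `<=` _) _; first by move=> _ ->.
  by apply: open_nbhs_nbhs; split=> //; apply: prime_factor_open1; exact/eqP.
(* Here [x] lies in every neighborhood of [a], so [x] is still detected by a
   map into [X]: the one that sends all other points to [a]. *)
have inx V : open V -> V a -> V x.
  move=> oV Va; apply: contrapT => nVx; apply: nax.
  rewrite prime_factor_nbhs_center; apply: (@filterS _ _ _ V).
    by move=> v Vv vx; apply: nVx; rewrite -vx.
  exact: open_nbhs_nbhs.
have [V [oV [[Vx nVa]|[Va nVx]]]] := epireflective_T0 AX (elimN eqP xa);
  last first.
  by have := inx _ oV Va.
pose f (y : prime_factor a) : X := if y == x then x else a.
have cf : continuous f.
  apply/continuousP => W oW; have [Wa|nWa] := pselect (W a).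
    suff -> : f @^-1` W = setT by exact: openT.
    apply/seteqP; split=> // y _ /=; rewrite /f; case: ifP => // _; exact: inx.
  have [Wx|nWx] := pselect (W x).
    suff -> : f @^-1` W = [set x] by [].
    apply/seteqP; split=> y /=; rewrite /f; first by case: eqP.
    by move=> ->; rewrite eqxx.
  suff -> : f @^-1` W = set0 by exact: open0.
  by apply/seteqP; split=> y //=; rewrite /f; case: eqP.
have /(_ V) := Fx _ _ AX cf; rewrite {1}/f eqxx.
have nV : @nbhs X X x V by apply: open_nbhs_nbhs.
move=> /(_ nV) FfV; have {}FfV : F (f @^-1` V) by exact: FfV.
by apply: filterS FfV => y; rewrite /preimage/= /f; case: eqP.
Qed.

End epireflective_class.

(** * Hausdorff prime spaces *)

Definition hausdorff_prime (Z : topologicalType) (z : Z) : Prop :=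
  (forall p : Z, p <> z -> clopen [set p]) /\ ~ open [set z].

Section hausdorff_prime.
Variables (Z : topologicalType) (z : Z).
Hypothesis clopen1 : forall p : Z, p <> z -> clopen [set p].

Lemma open_avoiding_center (U : set Z) : ~ U z -> open U.
Proof.
move=> nUz; rewrite openE => p Up.
apply: (@filterS _ _ _ [set p]); first by move=> _ ->.
apply: open_nbhs_nbhs; split=> //.
by apply: (clopen1 _).1 => pz; rewrite -pz in nUz.
Qed.

Lemma clopen_at_center (U : set Z) : open U -> U z -> clopen U.
Proof.
by move=> oU Uz; split=> //; rewrite -openC; apply: open_avoiding_center.
Qed.

(** Clopen sets separate points and form a base, so maps to [bool] suffice. *)
Lemma epireflective_hausdorff_prime (A : space_class) :
  isomorphism_closed A -> epireflective A -> A bool -> A Z.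
Proof.
move=> isoA epiA Abool; apply: epireflective_initial => //.
  move=> p p' pp'.
  (* [s] is whichever of the two points is known to differ from [z]. *)
  have [s [clos ss']] : exists s, clopen [set s] /\ (p = s <-> p' <> s).
    have [pz|pz] := pselect (p = z).
      exists p'; split; first by apply: clopen1 => p'z; apply: pp'; rewrite pz.
      by split.
    exists p; split; first exact: clopen1.
    by split=> // _ /esym.
  exists bool, (fun y => `[< [set s] y >]); split=> //.
    exact: clopen_indicator.
  move=> /(congr1 is_true); rewrite !asboolE /= => ps.
  by rewrite ps in ss'; tauto.
move=> F p FF Fp U; rewrite nbhsE => -[V [oV Vp] VU].
have [pz|pz] := pselect (p = z).
  apply: filterS VU _; apply: (class_cvg_clopen Abool Fp) => //.
  by apply: clopen_at_center => //; rewrite -pz.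
have F1 : F [set p] by apply: (class_cvg_clopen Abool Fp) => //; exact: clopen1.
by apply: filterS F1 => _ ->; exact: VU.
Qed.

End hausdorff_prime.

(** * Clopen decompositions and local connectedness *)

Definition final_space (X : topologicalType) (T : choiceType) (q : X -> T) :
  Type := T.

Section final_topology.
Variables (X : topologicalType) (T : choiceType) (q : X -> T).
Local Notation Q := (final_space q).

Let op : set_system Q := [set U | open (q @^-1` U)].

Let opT : op setT. Proof. by rewrite /op /= preimage_setT; exact: openT. Qed.

Let opI : setI_closed op.
Proof. by move=> U V oU oV; exact: openI. Qed.

Let op_bigU (I : Type) (f : I -> set Q) :
  (forall i, op (f i)) -> op (\bigcup_i f i).
Proof. by move=> of_; apply: bigcup_open => i _; exact: of_. Qed.

HB.instance Definition _ := Choice.on Q.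
HB.instance Definition _ := isOpenTopological.Build Q opT opI op_bigU.

Lemma final_space_open (U : set Q) : open U = open (q @^-1` U).
Proof. by []. Qed.

Lemma quotient_map_final : (forall t, exists x, q x = t) ->
  quotient_map (q : X -> Q).
Proof. by []. Qed.

End final_topology.

(** A point other than the center has a member of [G] as its preimage, hence is clopen; the preimage
    of the center is the complement that is not open. *)
Lemma disjoint_clopen_quotient (Y : topologicalType) (x : Y) (G : set (set Y)) :
  G `<=` [set E | [/\ clopen E, E !=set0 & ~ E x]] -> trivIset G id ->
  ~ open (~` \bigcup_(E in G) E) ->
  exists (Z : topologicalType) (z : Z) (q : Y -> Z),
    quotient_map q /\ hausdorff_prime z.
Proof.
move=> GP tG nopen.
(* [c y] is the member of [G] containing [y], or [set0] if there is none. Members of [G] being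
   nonempty, the fibres of [c] are exactly the sets to collapse. *)
pose c y := \bigcup_(E in [set E | G E /\ E y]) E.
have cE y E : G E -> E y -> c y = E.
  move=> GE Ey; apply/seteqP; split => [y' [E' [GE' E'y] E'y']|y' Ey'].
    by rewrite (tG E E') //; exists y.
  by exists E.
have c0 y : c y <> set0 -> exists2 E, G E & E y.
  by move=> /eqP/set0P[y' [E [GE Ey] _]]; exists E.
have cx : c x = set0.
  by apply: contrapT => /c0[E /GP[_ _]].
have cpre y E : G E -> c y = E -> E y.
  move=> GE cyE; have [E' GE' E'y] : exists2 E', G E' & E' y.
    apply: c0; rewrite cyE; apply/eqP/set0P; by have [] := GP _ GE.
  by rewrite -cyE (cE _ _ GE').
pose q y : range c := SigSub (mem_set (imageT c y)).
have qE y y' : q y = q y' <-> c y = c y'.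
  by split=> [/(congr1 val)//|cyy']; exact: val_inj.
have q_surj (p : range c) : exists y, q y = p.
  have [y _ cy] := set_valP p; exists y; exact: val_inj.
exists (final_space q), (q x), q; split; first exact: quotient_map_final.
split; last first.
  rewrite final_space_open; congr (~ open _): nopen.
  apply/seteqP; split => y /=.
    move=> nGy; apply/qE; rewrite cx; apply: contrapT => /c0[E GE Ey].
    by apply: nGy; exists E.
  move=> /qE; rewrite cx => cy0 [E GE Ey].
  by have := Ey; rewrite -(cE _ _ GE Ey) cy0.
move=> p; have [y <-] := q_surj p => qyx.
have [E GE Ey] : exists2 E, G E & E y.
  by apply: c0 => cy0; apply: qyx; apply/qE; rewrite cx.
have [[oE cloE] _ _] := GP _ GE.
have qpre : q @^-1` [set q y] = E.
  apply/seteqP; split => y' /=.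
    by move=> /qE; rewrite (cE _ _ GE Ey); exact: cpre.
  by move=> Ey'; apply/qE; rewrite (cE _ _ GE Ey) (cE _ _ GE Ey').
split; first by change (open (q @^-1` [set q y])); rewrite qpre.
rewrite -openC; change (open (q @^-1` (~` [set q y]))).
by rewrite -preimage_setC qpre openC.
Qed.

(** A separation of [D] would yield a further clopen set avoiding [x], against the maximality of
    [G]. *)
Lemma connected_clopen_nbhs (Y : topologicalType) (x : Y) :
  (forall (Z : topologicalType) (z : Z) (q : Y -> Z),
    quotient_map q -> ~ hausdorff_prime z) ->
  exists D : set Y, [/\ open D, D x & connected D].
Proof.
move=> noprime.
have [G [GP tG maxG]] := @ex_maximal_disjoint_subcollection _ _ (@id (set Y))
  [set E | [/\ clopen E, E !=set0 & ~ E x]].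
set D := ~` \bigcup_(E in G) E.
have oD : open D.
  apply: contrapT => nopen.
  have [Z [z [q [quoq primez]]]] := disjoint_clopen_quotient GP tG nopen.
  exact: noprime quoq primez.
have cD : closed D.
  by apply: open_closedC; apply: bigcup_open => E /GP[[]].
have Dx : D x by case=> E /GP[].
exists D; split => // K K0 [C oC KC] [C' cC' KC'].
have oK : open K by rewrite KC; exact: openI.
have cK : closed K by rewrite KC'; exact: closedI.
have KD : K `<=` D by rewrite KC => y [].
apply: contrapT => KnD.
suff [E [[cloE [e Ee] nEx] ED]] :
    exists E, [/\ clopen E, E !=set0 & ~ E x] /\ E `<=` D.
  have nGE : ~ G E by move=> GE; apply: (ED e Ee); exists E.
  apply: (maxG (G `|` [set E])).
  - split; last by move=> /(_ E); apply: contra_not nGE; apply; right.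
    by move=> ? ?; left.
  - by move=> _ [/GP//|->]; split => //; exists e.
  - move=> E1 E2 [G1|->] [G2|->] // [y [E1y E2y]].
    + by apply: tG => //; exists y.
    + by case: (ED y E2y); exists E1.
    + by case: (ED y E1y); exists E2.
(* Of [K] and its complement in [D], take the one that avoids [x]. *)
have [Kx|nKx] := pselect (K x); last by exists K; split.
exists (D `\` K); split; last by move=> y [].
split; last by case.
  rewrite setDE; split; first by apply: openI => //; exact: closed_openC.
  by apply: closedI => //; exact: open_closedC.
apply/set0P/negP => /eqP DK0; apply: KnD; apply/seteqP; split=> // y Dy.
by apply: contrapT => nKy; have : (D `\` K) y by []; rewrite DK0.
Qed.

Lemma hereditary_locally_connected (B : space_class) :
  hereditary B ->
  (forall (Y Z : topologicalType) (z : Z) (q : Y -> Z), B Y ->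
    quotient_map q -> ~ hausdorff_prime z) ->
  forall X : topologicalType, B X -> locally_connected X.
Proof.
move=> herB noprime X BX x U oU Ux.
have [D [oD Dx cD]] := @connected_clopen_nbhs U (SigSub (mem_set Ux))
  (fun Z z q => @noprime U Z z q (herB X U BX)).
have [V oV VD] := oD.
exists (set_val @` D); split.
- suff -> : set_val @` D = V `&` U by exact: openI.
  apply/seteqP; split => y.
    case=> u Du <-; split; last exact: set_valP.
    by have : (set_val @^-1` V) u by rewrite VD.
  move=> [Vy Uy]; exists (SigSub (mem_set Uy)) => //.
  by rewrite -VD.
- by exists (SigSub (mem_set Ux)).
- apply: connected_continuous_connected => //.
  exact/continuous_subspaceT/initial_continuous.
- by move=> _ [u _ <-]; exact: set_valP.
Qed.

(** * Gluing a copy of [Z] to each point of [X] *)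

Section comb.
Variables (X Z : topologicalType) (z : Z).

Definition comb_piece (i : option X) : topologicalType :=
  if i is Some _ then Z else X.

Definition comb_glue (s : {i : option X & comb_piece i}) : X * Z :=
  let: existT i p := s in
  match i return comb_piece i -> X * Z with
  | Some x => fun p => (x, p)
  | None => fun x => (x, z)
  end p.

(* The quotient of the disjoint union of [X] and of copies of [Z] indexed by
   [X] that identifies each [x] with the point [z] of the copy with index [x].
   The spine [X] is the set of all [(x, z)]. *)
Definition comb : Type := final_space comb_glue.
HB.instance Definition _ := Topological.on comb.

Lemma comb_openP (U : set comb) :
  open U <-> open [set x | U (x, z)] /\ forall x, open [set p | U (x, p)].
Proof.
rewrite final_space_open sigT_openP; split=> [oU|[oX oZ] [x|]].
- by split=> [|x]; [exact: (oU None)|exact: (oU (Some x))].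
- exact: oZ.
- exact: oX.
Qed.

Lemma comb_glue_quotient : quotient_map (comb_glue : _ -> comb).
Proof.
by apply: quotient_map_final => -[x p]; exists (existT comb_piece (Some x) p).
Qed.

Lemma comb_fst_continuous : continuous (fst : comb -> X).
Proof.
apply/continuousP => U oU; apply/comb_openP; split=> // x /=.
have [Ux|nUx] := pselect (U x).
  by rewrite (_ : mkset _ = setT); [exact: openT|apply/seteqP; split].
by rewrite (_ : mkset _ = set0); [exact: open0|apply/seteqP; split].
Qed.

Hypothesis clopen1 : forall p : Z, p <> z -> clopen [set p].

Lemma comb_clopen1 (x : X) (p : Z) : p <> z -> clopen [set (x, p) : comb].
Proof.
move=> pz; have [op cp] := clopen1 pz.
split; last rewrite -openC; apply/comb_openP; split => [|y] /=.
- rewrite (_ : mkset _ = set0); first exact: open0.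
  by apply/seteqP; split => // y /= [_ /esym].
- have [->|yx] := pselect (y = x).
    rewrite (_ : mkset _ = [set p]) //.
    by apply/seteqP; split=> p' /= [->].
  rewrite (_ : mkset _ = set0); first exact: open0.
  by apply/seteqP; split => // p' /= [].
- rewrite (_ : mkset _ = setT); first exact: openT.
  by apply/seteqP; split => // y _ /= [_ /esym].
- have [->|yx] := pselect (y = x).
    rewrite (_ : mkset _ = ~` [set p]); first exact: closed_openC.
    apply/seteqP; split=> p' /= pp'; last by case.
    by move=> pE; apply: pp'; rewrite pE.
  rewrite (_ : mkset _ = setT); first exact: openT.
  by apply/seteqP; split => // p' _ /= [].
Qed.

(** The complement misses the spine and meets each copy of [Z] in a set avoiding [z], hence open. *)
Lemma comb_clopen_spine (K : set comb) :
  open K -> (forall x, K (x, z)) -> clopen K.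
Proof.
move=> oK Kz; split=> //; rewrite -openC; apply/comb_openP; split=> [|x].
  rewrite (_ : mkset _ = set0); first exact: open0.
  by apply/seteqP; split => // x /= /(_ (Kz x)).
by apply: (open_avoiding_center clopen1) => /= /(_ (Kz x)).
Qed.

Lemma epireflective_comb (A : space_class) :
  isomorphism_closed A -> epireflective A -> A bool -> A X -> A comb.
Proof.
move=> isoA epiA Abool AX; apply: epireflective_initial => //.
  have ind (w w' : comb) : w <> w' -> w.2 <> z ->
      exists f : comb -> bool, continuous f /\ f w <> f w'.
    case: w => x p ww' /= pz.
    exists (fun w => `[< [set (x, p) : comb] w >]); split.
      exact/clopen_indicator/comb_clopen1.
    rewrite asboolT // asboolF // => w'E; exact: ww'.
  move=> w w' ww'.
  have [w1|w1] := pselect (w.1 = w'.1); last first.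
    by exists X, fst; split => //; exact: comb_fst_continuous.
  have [wz|/(ind _ _ ww')[f [cf fww']]] := pselect (w.2 = z); last first.
    by exists bool, f.
  have [w'z|/(ind w' w)[|f [cf fww']]] := pselect (w'.2 = z).
  - case: ww'; rewrite (surjective_pairing w) (surjective_pairing w').
    by rewrite w1 wz w'z.
  - by move=> w'w; apply: ww'.
  - by exists bool, f; split => // /esym.
move=> F [x p] FF Fw U; rewrite nbhsE => -[V [oV Vw] VU].
have [pz|pz] := pselect (p = z); last first.
  have F1 := class_cvg_clopen Abool Fw (comb_clopen1 x pz) erefl.
  by apply: filterS F1 => _ ->; exact: VU.
have [oVX oVZ] := (comb_openP V).1 oV.
pose O := [set y | V (y, z)].
(* [K] agrees with [V] over [O] and is everything elsewhere. It contains the spine, hence is clopen,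
   and [V] contains its part over [O]. *)
pose K : set comb := [set w | O w.1 -> V w].
have FO : F (fst @^-1` O).
  apply: (Fw X fst AX comb_fst_continuous); apply: open_nbhs_nbhs; split => //.
  by rewrite /O /= -pz.
have FK : F K.
  apply: (class_cvg_clopen Abool Fw); last by move=> _.
  apply: comb_clopen_spine; last by move=> y.
  apply/comb_openP; split=> [|y].
    rewrite (_ : mkset _ = setT); first exact: openT.
    by apply/seteqP; split => // y _.
  have [Oy|nOy] := pselect (O y).
    rewrite (_ : mkset _ = [set p | V (y, p)]) //.
    by apply/seteqP; split => p'; [move=> /(_ Oy)|move=> ? _].
  rewrite (_ : mkset _ = setT); first exact: openT.
  by apply/seteqP; split => // p' _ /= /nOy.
by apply: filterS2 FO FK => w Ow Kw; apply: VU; exact: Kw.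
Qed.

Variable a : X.

Definition comb_teeth : set comb :=
  [set w | w = (a, z) \/ (w.1 <> a /\ w.2 <> z)].

(** Over points other than [a] the feet are missing, so these points become isolated; neighborhoods
    of [a] are still governed by the spine. *)
Lemma comb_teeth_quotient : ~ open [set z] ->
  quotient_map (fun w : comb_teeth => (val w).1 : prime_factor a).
Proof.
move=> nz; have nzE (O : set Z) : open O -> O z -> exists2 p, O p & p <> z.
  move=> oO Oz; apply: contrapT => nO; apply: nz; rewrite (_ : [set z] = O) //.
  apply/seteqP; split => [_ ->//|p Op /=].
  by apply: contrapT => pz; apply: nO; exists p.
have tooth x p : x <> a -> p <> z -> comb_teeth (x, p) by right.
split=> [x|U].
  have [->|xa] := pselect ((x : X) = a).
    by exists (SigSub (mem_set (or_introl erefl : comb_teeth (a, z)))).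
  have [p _ pz] := nzE setT openT I.
  by exists (SigSub (mem_set (tooth x p xa pz))).
split=> [oU|[O oO OE]].
  (* The preimage of [U] without the spine points outside the interior of [U] in [X]; its trace on
     the spine is that interior. *)
  exists [set w : comb | U w.1 /\ (w.2 = z -> nbhs w.1 (U : set X))].
    apply/comb_openP; split=> [|x] /=.
      rewrite (_ : mkset _ = interior (U : set X)); first exact: open_interior.
      apply/seteqP; split=> [x /= [_]|x /= Ux]; first exact.
      by split=> //; exact: nbhs_singleton Ux.
    have [Ux|nUx] := pselect (U x); last first.
      rewrite (_ : mkset _ = set0); first exact: open0.
      by apply/seteqP; split=> // p /= [].
    have [xU|nxU] := pselect (nbhs x (U : set X)).
      rewrite (_ : mkset _ = setT); first exact: openT.
      by apply/seteqP; split.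
    by apply: (open_avoiding_center clopen1) => /= -[_ /(_ erefl)].
  apply/seteqP; split=> -[w wT]; first by case.
  move=> /= Uw; split=> //; case: (set_mem wT) => [wE _|[_ wz] /wz //].
  move: Uw; rewrite set_valE /= wE /= => Ua.
  rewrite -prime_factor_nbhs_center; exact: open_nbhs_nbhs.
rewrite openE => x Ux; have [xa|xa] := pselect ((x : X) = a); last first.
  apply: filterS (_ : [set x] `<=` _) _; first by move=> _ ->.
  by apply: open_nbhs_nbhs; split=> //; exact: prime_factor_open1.
rewrite xa in Ux *; rewrite /interior prime_factor_nbhs_center.
have OU (w : comb) (wT : comb_teeth w) : O w <-> U w.1.
  have := congr1 (fun S : set comb_teeth => S (SigSub (mem_set wT))) OE.
  by rewrite /preimage /= => ->.
have [oOX oOZ] := (comb_openP O).1 oO.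
have Oaz : O (a, z) by apply/OU => //; left.
(* If [O] contains the foot of [y], it contains another point of that copy of [Z], since [z] is not
   isolated; that point lies in [comb_teeth] and forces [U y]. *)
apply: (@filterS _ _ _ [set x | O (x, z)]); last exact: open_nbhs_nbhs.
move=> y Oyz; have [->//|ya] := pselect (y = a).
have [p Oyp pz] := nzE _ (oOZ y) Oyz.
by apply: (OU (y, p) (tooth y p ya pz)).1.
Qed.

End comb.

Theorem corollary6p8 (A B : space_class) (subA : subcategory A)
  (epiA : epireflective A) (I2_notin_A : ~ A I2)
  (subB : subcategory B) (hadB : HAD_class A B)
  (nlcB : exists X : topologicalType, B X /\ ~ locally_connected X) :
  closed_under_prime_factors B.
Proof.
have [isoA ntA] := subA; have [[BA addB divB] herB] := hadB.
have Abool := epireflective_bool isoA epiA I2_notin_A ntA.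
have [Z [z [BZ [clopen1 nz]]]] :
    exists (Z : topologicalType) (z : Z), B Z /\ hausdorff_prime z.
  apply: contrapT => noprime; case: nlcB => X0 [BX0]; apply.
  apply: hereditary_locally_connected herB _ _ BX0 => Y Z z q BY quoq primez.
  apply: noprime; exists Z, z; split => //; apply: divB quoq BY _.
  by apply: epireflective_hausdorff_prime => //; exact: primez.1.
move=> X a BX.
have Bsum : B {i : option X & comb_piece Z i} by apply: addB => -[].
have Bcomb : B (comb X z).
  apply: divB (comb_glue_quotient X z) Bsum _.
  by apply: epireflective_comb => //; exact: BA.
apply: divB (comb_teeth_quotient clopen1 a nz) _ _; first exact: herB.
by apply: epireflective_prime_factor => //; exact: BA.
Qed.
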